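(* Let $1\le k\le n$. The operator space $H_n^k$ is completely isometric to the space $\mathcal{C}^{n,k}$ of creation operators, i.e. there is a linear bijection $T:H_n^k\to\mathcal{C}^{n,k}$ with $\|T\|_{\mathrm{cb}}=\|T^{-1}\|_{\mathrm{cb}}=1$.
   Context: Definition of $H_n^k$. Let $1\le k\le n$. Let $I=\{i_1<\cdots<i_{k-1}\}$ range over the subsets of $\{1,\ldots,n\}$ of cardinality $k-1$ (there are $q=\binom{n}{k-1}$ of them) and $J=\{j_1<\cdots<j_{n-k}\}$ over the subsets of cardinality $n-k$ (there are $p=\binom{n}{n-k}$ of them), each collection ordered lexicographically. Let $\{e_I\}$ and $\{e_J\}$ be the canonical bases of column vectors of $\mathbf{C}^q$ and $\mathbf{C}^p$, indexed by these subsets, and let $e_{J,I}=e_Je_I^t\in M_{p,q}(\mathbf{C})=B(\mathbf{C}^q,\mathbf{C}^p)$. For $1\le i\le n$ put $$b_i^{n,k}=\sum_{I\cap J=\emptyset,\ (I\cup J)^c=\{i\}}\epsilon(I,i,J)\,e_{J,I},$$ where $\epsilon(I,i,J)$ is the signature of the permutation taking $(i_1,\ldots,i_{k-1},i,j_1,\ldots,j_{n-k})$ to $(1,\ldots,n)$. Then $H_n^k$ is the linear span of $b_1^{n,k},\ldots,b_n^{n,k}$, with the operator space structure inherited from $B(\mathbf{C}^q,\mathbf{C}^p)$. Creation operators. For $h\in\mathbf{C}^n$, let $C_h^{n,k}:\wedge^{k-1}\mathbf{C}^n\to\wedge^k\mathbf{C}^n$ be given by $C_h^{n,k}(h_1\wedge\cdots\wedge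 h_{k-1})=h\wedge h_1\wedge\cdots\wedge h_{k-1}$, where $\wedge^r\mathbf{C}^n$ has the inner product $(x_1\wedge\cdots\wedge x_r\,|\,y_1\wedge\cdots\wedge y_r)=\det[(x_i|y_j)]$ (and $\wedge^0\mathbf{C}^n=\mathbf{C}$). With $e_1,\ldots,e_n$ the canonical basis of $\mathbf{C}^n$, $\mathcal{C}^{n,k}$ is the linear span of $C_{e_1}^{n,k},\ldots,C_{e_n}^{n,k}$ in $B(\wedge^{k-1}\mathbf{C}^n,\wedge^k\mathbf{C}^n)$, with the inherited operator space structure. *)

(* Defs.v *)
From HB Require Import structures.
From mathcomp Require Import all_boot all_order all_fingroup all_algebra.
From mathcomp Require Import sesquilinear.
From mathcomp Require Import complex.
From mathcomp Require Import all_classical all_reals ereal.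

Set Implicit Arguments.
Unset Strict Implicit.
Unset Printing Implicit Defensive.

Import Order.TTheory GRing.Theory Num.Theory.
Local Open Scope ring_scope.

Section FiniteDimensionalHilbertSpaces.
Variable R : realType.
Local Notation C := (R[i]).

(* Inner products are linear in the first variable. *)
Record hilbert := Hilbert {
  hsort :> vectType C;
  hdot : {dot hsort for (@Num.conj C)} }.

Definition dotcv n (u v : 'cV[C]_n) : C := \sum_a u a 0 * (v a 0)^*.

Lemma dotcvDl n (v : 'cV[C]_n) : linear_for *%R (fun u => dotcv u v).
Proof.
move=> a u w; rewrite /dotcv /= mulr_sumr -big_split /=; apply: eq_bigr => i _.
by rewrite !mxE mulrDl mulrA.
Qed.

Lemma dotcvDr n (u : 'cV[C]_n) : linear_for (@Num.conj C \; *%R) (fun v => dotcv u v).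
Proof.
move=> a v w; rewrite /dotcv /= mulr_sumr -big_split /=; apply: eq_bigr => i _.
by rewrite !mxE rmorphD rmorphM mulrDr mulrCA.
Qed.

HB.instance Definition _ n := bilinear_isBilinear.Build C _ _ C *%R
  (@Num.conj C \; *%R) (@dotcv n) (conj (@dotcvDl n) (@dotcvDr n)).

Lemma dotcv_herm n (u v : 'cV[C]_n) :
  dotcv u v = (-1) ^+ false * (dotcv v u)^*.
Proof.
rewrite mul1r /dotcv rmorph_sum; apply: eq_bigr => i _.
by rewrite rmorphM /= conjCK mulrC.
Qed.

HB.instance Definition _ n :=
  @isHermitianSesquilinear.Build C 'cV[C]_n false (@Num.conj C) (@dotcv n)
    (@dotcv_herm n).

Lemma dotcv_gt0 n (u : 'cV[C]_n) : u != 0 -> 0 < dotcv u u.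
Proof.
move=> u0; rewrite lt_def; apply/andP; split; last first.
  by apply: sumr_ge0 => i _; rewrite mul_conjC_ge0.
apply: contraNneq u0 => /eqP.
rewrite psumr_eq0; last by move=> i _; rewrite mul_conjC_ge0.
move=> /allP h; apply/eqP/matrixP=> i j; rewrite ord1 mxE; apply/eqP.
by have := h i (mem_index_enum _); rewrite mul_conjC_eq0.
Qed.

HB.instance Definition _ n :=
  isDotProduct.Build C 'cV[C]_n (@dotcv n) (@dotcv_gt0 n).

Definition Cn n : hilbert := @Hilbert 'cV[C]_n (@dotcv n).

Definition ebasis n (i : 'I_n) : Cn n := delta_mx i 0.

End FiniteDimensionalHilbertSpaces.

Notation "''[' u , v ]" := (hdot _ u v) : ring_scope.

Section OperatorSpaces.
Variable R : realType.
Local Notation C := (R[i]).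
Local Open Scope classical_set_scope.
Local Open Scope ereal_scope.

(* The norm of the Hilbert direct sum of m copies of H. *)
Definition hnormm (H : hilbert R) m (x : 'I_m -> H) : R :=
  Num.sqrt (\sum_j complex.Re '[x j, x j])%R.

(* The norm of M_m(B(H,K)) = B(H^m, K^m). *)
Definition mxopnorm (H K : hilbert R) m (A : 'M['Hom(H, K)]_m) : \bar R :=
  ereal_sup [set (hnormm (fun i => \sum_j A i j (x j))%R)%:E
            | x in [set x : 'I_m -> H | (hnormm x <= 1)%R]].

(* Subspaces of B(H,K) carry the matrix norms inherited from M_m(B(H,K)). *)
Definition cbnorm (H K H' K' : hilbert R)
    (E : {vspace 'Hom(H, K)}) (F : {vspace 'Hom(H', K')})
    (T : 'Hom(subvs_of E, subvs_of F)) : \bar R :=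
  ereal_sup [set r | exists m (A : 'M[subvs_of E]_m.+1),
    mxopnorm (map_mx vsval A) <= 1 /\
    r = mxopnorm (map_mx (fun a => vsval (T a)) A)].

Definition completely_isometric (H K H' K' : hilbert R)
    (E : {vspace 'Hom(H, K)}) (F : {vspace 'Hom(H', K')}) : Prop :=
  exists (T : 'Hom(subvs_of E, subvs_of F)) (T' : 'Hom(subvs_of F, subvs_of E)),
    [/\ cancel T T', cancel T' T, cbnorm T = 1 & cbnorm T' = 1].

End OperatorSpaces.

Section HomogeneousHilbertianSpaces.
Variable R : realType.
Local Notation C := (R[i]).
Variable n : nat.

(* The subsets of cardinality r, in the lexicographic order of their
   increasing enumerations. *)
Definition subsets r : seq {set 'I_n} :=
  sort (fun I J : {set 'I_n} => (enum I <= enum J :> seqlexi 'I_n)%O)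
       (enum [set I : {set 'I_n} | #|I| == r]).

Lemma size_subsets r : size (subsets r) = 'C(n, r).
Proof. by rewrite size_sort -cardE card_draws card_ord. Qed.

Definition subset_basis r (I : {set 'I_n}) : 'cV[C]_('C(n, r)) :=
  \col_a (nth finset.set0 (subsets r) a == I)%:R.

(* The signature of the s with s(i_1),...,s(i),s(j_1),... equal to 1,...,n
   (0 when there is no such permutation). *)
Definition eps (I : {set 'I_n}) (i : 'I_n) (J : {set 'I_n}) : C :=
  if [pick s : 'S_n | [seq s x | x <- enum I ++ i :: enum J] == enum 'I_n]
  is Some s then (-1) ^+ odd_perm s else 0.

Definition bmx k (i : 'I_n) : 'M[C]_('C(n, n - k), 'C(n, k.-1)) :=
  \sum_(I : {set 'I_n} | #|I| == k.-1)
   \sum_(J : {set 'I_n} | [&& #|J| == (n - k)%N, I :&: J == finset.set0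
                            & ~: (I :|: J) == [set i]])
     eps I i J *: (subset_basis (n - k) J *m (subset_basis k.-1 I)^T).

Definition Hnk k : {vspace 'Hom(Cn R 'C(n, k.-1), Cn R 'C(n, n - k))} :=
  <<[seq linfun (mulmx (bmx k i)) | i <- enum 'I_n]>>%VS.

End HomogeneousHilbertianSpaces.

Section CauchyBinet.
Variables (F : comNzRingType) (n r : nat).
Implicit Types (X : 'M[F]_(r, n)) (Z : 'M[F]_(n, r)) (t : {ffun 'I_r -> 'I_n}).

Lemma det_mulmx_expand X Z :
  \sum_(t : {ffun 'I_r -> 'I_n}) (\prod_i X i (t i)) * \det (rowsub t Z) = \det (X *m Z).
Proof.
rewrite [RHS](eq_bigr (fun s : 'S_r =>
  \sum_(t : {ffun 'I_r -> 'I_n}) (\prod_i X i (t i)) * ((-1) ^+ s * \prod_i (rowsub t Z) i (s i)))).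
  by rewrite exchange_big; apply: eq_bigr => t _; rewrite -mulr_sumr.
move=> s _; rewrite (eq_bigr (fun i => \sum_a X i a * Z a (s i))).
  rewrite bigA_distr_bigA mulr_sumr; apply: eq_bigr => t _.
  rewrite big_split mulrCA; congr (_ * (_ * _)).
  by apply: eq_bigr => i _; rewrite mxE.
by move=> i _; rewrite mxE.
Qed.

Lemma cauchy_binet X Z :
  \sum_(t : {ffun 'I_r -> 'I_n}) \det (colsub t X) * \det (rowsub t Z) = r`!%:R * \det (X *m Z).
Proof.
under eq_bigr do rewrite mulr_suml.
rewrite exchange_big /= (eq_bigr (fun=> \det (X *m Z))).
  by rewrite sumr_const card_Sn mulr_natl.
move=> s _; rewrite -det_mulmx_expand.
rewrite (reindex_inj (h := fun t : {ffun 'I_r -> 'I_n} => [ffun i => t ((s^-1)%g i)])); last first.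
  move=> t t' /ffunP e; apply/ffunP=> i.
  by have := e (s i); rewrite !ffunE permK.
apply: eq_bigr => t _; rewrite mulrAC.
have -> : rowsub [ffun i => t ((s^-1)%g i)] Z = row_perm (s^-1)%g (rowsub t Z).
  by apply/matrixP=> i j; rewrite !mxE ffunE.
rewrite row_permE det_mulmx det_perm odd_permV mulrA -signr_addb addbb mul1r.
rewrite mulrC; congr (_ * _).
by apply: eq_bigr => i _; rewrite mxE ffunE permK.
Qed.

End CauchyBinet.

Section ExteriorPowers.
Variable R : realType.
Local Notation C := (R[i]).
Variable n : nat.

Definition tset r (x : r.-tuple (Cn R n)) (i : 'I_r) (u : Cn R n) :
    r.-tuple (Cn R n) :=
  [tuple if j == i then u else tnth x j | j < r].

(* The Gram formula makes the wedges of strictly increasing families of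
   canonical basis vectors orthonormal, so these axioms determine the exterior
   power of C^n, with its inner product, up to a unique unitary map commuting
   with the wedges; ext_tensor below is a model. *)
Record exterior_power r := ExteriorPower {
  ext_space :> hilbert R;
  wedge : r.-tuple (Cn R n) -> ext_space;
  wedge_linear : forall x i (a : C) u v,
    wedge (tset x i (a *: u + v))
      = a *: wedge (tset x i u) + wedge (tset x i v);
  wedge_alt : forall x i j,
    i != j -> tnth x i = tnth x j -> wedge x = 0;
  wedge_span : forall U : {vspace ext_space},
    (forall x, wedge x \in U) -> U = fullv;
  wedge_dot : forall x y,
    '[wedge x, wedge y] = \det (\matrix_(i, j) '[tnth x i, tnth y j]) }.

Definition ebasis_tuple r (t : 'I_r -> 'I_n) : r.-tuple (Cn R n) :=
  [tuple ebasis R (t i) | i < r].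

Definition rows r (x : r.-tuple (Cn R n)) : 'M[C]_(r, n) :=
  \matrix_(i, a) tnth x i a 0.

Lemma gramE r (x y : r.-tuple (Cn R n)) :
  \matrix_(i, j) '[tnth x i, tnth y j] = rows x *m (map_mx Num.conj (rows y))^T.
Proof.
by apply/matrixP=> i j; rewrite !mxE; apply: eq_bigr => a _; rewrite !mxE.
Qed.

Lemma rows_ebasis r (t : 'I_r -> 'I_n) : rows (ebasis_tuple t) = rowsub t 1%:M.
Proof.
by apply/matrixP=> i a; rewrite !mxE tnth_mktuple mxE eqxx andbT eq_sym.
Qed.

Lemma map_rows_ebasis r (t : 'I_r -> 'I_n) :
  map_mx Num.conj (rows (ebasis_tuple t)) = rowsub t 1%:M.
Proof. by rewrite rows_ebasis; apply/matrixP=> i a; rewrite !mxE rmorph_nat. Qed.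

(* The antisymmetric tensors, written in coordinates in (C^n)^{(x) r}. *)
Section Model.
Variable r : nat.
Local Notation N := #|{ffun 'I_r -> 'I_n}|.

Definition tensor_wedge (x : r.-tuple (Cn R n)) : Cn R N :=
  \col_(a < N) ((sqrtC r`!%:R)^-1 * \det (colsub (enum_val a : {ffun 'I_r -> 'I_n}) (rows x))).

Definition tensor_span : {vspace Cn R N} :=
  <<[seq tensor_wedge (ebasis_tuple t) | t : {ffun 'I_r -> 'I_n}]>>%VS.

Lemma tensor_wedge_in x : tensor_wedge x \in tensor_span.
Proof.
have -> : tensor_wedge x = \sum_(t : {ffun 'I_r -> 'I_n})
    (\prod_i rows x i (t i)) *: tensor_wedge (ebasis_tuple t).
  apply/matrixP=> a j; rewrite mxE summxE.
  under eq_bigr do rewrite !mxE mulrCA rows_ebasis.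
  rewrite -mulr_sumr; congr (_ * _).
  rewrite -[X in colsub _ X]mulmx1 -mulmx_colsub -det_mulmx_expand.
  by apply: eq_bigr => t _; congr (_ * \det _); apply/matrixP=> i k; rewrite !mxE.
apply: memv_suml => t _; apply/memvZ/memv_span/mapP.
by exists t; rewrite ?mem_enum.
Qed.

Definition tensor_dot (u v : subvs_of tensor_span) : C := '[vsval u, vsval v].

Lemma tensor_dotDl v : linear_for *%R (fun u => tensor_dot u v).
Proof. by move=> a u w; rewrite /tensor_dot linearP /= linearPl. Qed.

Lemma tensor_dotDr u : linear_for (@Num.conj C \; *%R) (fun v => tensor_dot u v).
Proof. by move=> a v w; rewrite /tensor_dot [vsval (_ + _)]linearP linearPr. Qed.

HB.instance Definition _ := bilinear_isBilinear.Build C _ _ C *%R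
  (@Num.conj C \; *%R) tensor_dot (conj tensor_dotDl tensor_dotDr).

Lemma tensor_dot_herm u v :
  tensor_dot u v = (-1) ^+ false * (tensor_dot v u)^*.
Proof. exact: hermC. Qed.

HB.instance Definition _ :=
  @isHermitianSesquilinear.Build C (subvs_of tensor_span) false (@Num.conj C)
    tensor_dot tensor_dot_herm.

Lemma tensor_dot_gt0 u : u != 0 -> 0 < tensor_dot u u.
Proof.
move=> u0; rewrite /tensor_dot; apply: dotcv_gt0.
by apply: contraNneq u0 => h; apply/eqP/val_inj.
Qed.

HB.instance Definition _ :=
  isDotProduct.Build C (subvs_of tensor_span) tensor_dot tensor_dot_gt0.

Definition tensor_space : hilbert R := @Hilbert R (subvs_of tensor_span) tensor_dot.

Definition tensor_wedge_sub x : tensor_space := vsproj tensor_span (tensor_wedge x).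

Lemma tensor_wedgeK x : vsval (tensor_wedge_sub x) = tensor_wedge x.
Proof. exact/vsprojK/tensor_wedge_in. Qed.

Lemma tensor_wedge_linear x i (a : C) u v :
  tensor_wedge_sub (tset x i (a *: u + v)) =
  a *: tensor_wedge_sub (tset x i u) + tensor_wedge_sub (tset x i v).
Proof.
apply: val_inj; rewrite linearP /= !tensor_wedgeK.
apply/matrixP=> b j; rewrite !mxE mulrCA -mulrDr; congr (_ * _).
rewrite -[X in _ = _ + X]mul1r.
apply: (determinant_multilinear (i0 := i)).
- by apply/matrixP=> k l; rewrite !mxE !tnth_mktuple eqxx !mxE mul1r.
- by apply/matrixP=> k l; rewrite !mxE !tnth_mktuple eq_sym (negPf (neq_lift _ _)).
- by apply/matrixP=> k l; rewrite !mxE !tnth_mktuple eq_sym (negPf (neq_lift _ _)).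
Qed.

Lemma tensor_wedge_alt x i j :
  i != j -> tnth x i = tnth x j -> tensor_wedge_sub x = 0.
Proof.
move=> ij e; apply: val_inj; rewrite /= tensor_wedgeK.
apply/matrixP=> b k; rewrite !mxE (determinant_alternate ij) ?mulr0 //.
by move=> l; rewrite !mxE e.
Qed.

Lemma tensor_wedge_span (U : {vspace tensor_space}) :
  (forall x, tensor_wedge_sub x \in U) -> U = fullv.
Proof.
move=> hU; apply/eqP; rewrite eqEsubv subvf; apply/subvP=> w _.
have : (tensor_span <= linfun vsval @: U)%VS.
  apply/span_subvP=> _ /mapP[t _ ->]; rewrite -tensor_wedgeK.
  by rewrite -[vsval _](lfunE vsval) memv_img.
move=> /subvP/(_ _ (subvsP w))/memv_imgP[u uU].
by rewrite lfunE /= => /val_inj ->.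
Qed.

Lemma tensor_wedge_dot x y :
  '[tensor_wedge_sub x, tensor_wedge_sub y] =
  \det (\matrix_(i, j) '[tnth x i, tnth y j]).
Proof.
rewrite gramE /hdot /= /tensor_dot !tensor_wedgeK /= /dotcv.
have r0 : r`!%:R != 0 :> C by rewrite pnatr_eq0 -lt0n fact_gt0.
rewrite -[RHS](mulKf r0) -cauchy_binet mulr_sumr.
rewrite [RHS](reindex (@enum_val _ {ffun 'I_r -> 'I_n})) /=; last first.
  exact: onW_bij (enum_val_bij _).
apply: eq_bigr => a _; rewrite !mxE rmorphM fmorphV /=.
have -> : (sqrtC r`!%:R)^* = sqrtC r`!%:R :> C.
  by apply: geC0_conj; rewrite sqrtC_ge0 ler0n.
rewrite mulrACA -invfM -expr2 sqrtCK -det_map_mx -[X in _ * (_ * X)]det_tr.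
by congr (_ * (_ * \det _)); apply/matrixP=> i j; rewrite !mxE.
Qed.

Definition ext_tensor : exterior_power r :=
  ExteriorPower tensor_wedge_linear tensor_wedge_alt tensor_wedge_span
    tensor_wedge_dot.

End Model.

Lemma hdotBl (H : hilbert R) (u v w : H) : '[u - v, w] = '[u, w] - '[v, w].
Proof. exact: linearBl. Qed.

Lemma hdotZl (H : hilbert R) (a : C) (u w : H) : '[a *: u, w] = a * '[u, w].
Proof. exact: linearZl_LR. Qed.

Lemma hdot_suml (H : hilbert R) (I : finType) (F : I -> H) (w : H) :
  '[\sum_i F i, w] = \sum_i '[F i, w].
Proof. exact: linear_sumlz. Qed.

Section Creation.
Variables (E : forall r, exterior_power r) (r : nat) (h : Cn R n).

Lemma ext_eq0 s (d : E s) :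
  (forall y : s.-tuple (Cn R n), '[d, wedge (E s) y] = 0) -> d = 0.
Proof.
move=> hd; apply/eqP; rewrite -(dnorm_eq0 (hdot (E s))).
pose f (v : E s) : C^o := '[v, d].
have fL : linear f by move=> a u v; rewrite /f linearPl.
pose fl := GRing.isLinear.Build C (E s) C^o *:%R f fL.
pose F : {linear E s -> C^o} := HB.pack f fl.
have /(_ (lker (linfun F))) := @wedge_span _ (E s).
move=> /(_ _)/[dup] hk; rewrite -[_ == 0]/(F d == 0) -lfunE -memv_ker hk ?memvf //.
by move=> y; rewrite memv_ker lfunE /= /f hermC /= hd rmorph0 mulr0.
Qed.

Definition minor_rows (y : r.+1.-tuple (Cn R n)) (j : 'I_r.+1) : 'M[C]_(n, r) :=
  \matrix_(a, l) (tnth y (lift j l) a 0)^*.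

Lemma wedge_cons_dot (x : r.-tuple (Cn R n)) (y : r.+1.-tuple (Cn R n)) :
  '[wedge (E r.+1) [tuple of h :: x], wedge (E r.+1) y] =
  \sum_j '[h, tnth y j] * ((-1) ^+ j * \det (rows x *m minor_rows y j)).
Proof.
rewrite wedge_dot (expand_det_row _ ord0); apply: eq_bigr => j _.
rewrite mxE tnth0 /cofactor; congr (_ * (_ * \det _)).
apply/matrixP=> i l; rewrite !mxE -[lift ord0 i]/(lift ord0 i) tnthS.
by apply: eq_bigr => a _; rewrite !mxE.
Qed.

Definition creation_fun (w : E r) : E r.+1 :=
  (r`!%:R)^-1 *: \sum_(t : {ffun 'I_r -> 'I_n})
    '[w, wedge (E r) (ebasis_tuple t)] *: wedge (E r.+1) [tuple of h :: ebasis_tuple t].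

Lemma creation_fun_linear : linear creation_fun.
Proof.
move=> a u v; rewrite /creation_fun scalerA mulrC -scalerA -scalerDr.
congr (_ *: _); rewrite scaler_sumr -big_split; apply: eq_bigr => t _ /=.
by rewrite linearPl scalerDl scalerA.
Qed.

Lemma creation_exists : exists A : 'Hom(E r, E r.+1),
  forall x, A (wedge (E r) x) = wedge (E r.+1) [tuple of h :: x].
Proof.
pose fl := GRing.isLinear.Build C (E r) (E r.+1) *:%R creation_fun creation_fun_linear.
pose L : {linear E r -> E r.+1} := HB.pack creation_fun fl.
exists (linfun L) => x; rewrite lfunE /=; apply/eqP; rewrite -subr_eq0.
apply/eqP/ext_eq0 => y; rewrite hdotBl wedge_cons_dot.
rewrite /creation_fun hdotZl hdot_suml.
have r0 : r`!%:R != 0 :> C by rewrite pnatr_eq0 -lt0n fact_gt0.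
apply/eqP; rewrite subr_eq0 -(inj_eq (mulfI r0)) mulrA mulfV // mul1r; apply/eqP.
rewrite mulr_sumr.
under eq_bigr do rewrite hdotZl wedge_cons_dot mulr_sumr.
rewrite exchange_big; apply: eq_bigr => j _ /=.
rewrite mulrCA [X in _ = _ * X]mulrCA -cauchy_binet !mulr_sumr.
apply: eq_bigr => t _.
rewrite mulrCA [X in _ * X = _]mulrCA wedge_dot gramE map_rows_ebasis rows_ebasis.
congr (_ * (_ * (_ * _))); congr (\det _).
  by apply/matrixP=> i l; rewrite !mxE (bigD1 (t l)) //= !mxE eqxx mulr1 big1
     ?addr0 // => a /negPf; rewrite !mxE eq_sym => ->; rewrite mulr0.
by rewrite mul_rowsub_mx mul1mx.
Qed.

Definition creation : 'Hom(E r, E r.+1) := sval (cid creation_exists).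

Lemma creationE x : creation (wedge (E r) x) = wedge (E r.+1) [tuple of h :: x].
Proof. exact: (svalP (cid creation_exists)). Qed.

End Creation.

(* For k >= 1 these operators go from the (k-1)-st to the k-th exterior power. *)
Definition Cnk (E : forall r, exterior_power r) k :
    {vspace 'Hom(E k.-1, E k.-1.+1)} :=
  <<[seq creation E k.-1 (ebasis R i) | i <- enum 'I_n]>>%VS.

End ExteriorPowers.

(* Main.v *)
(* The sets I and J index orthonormal bases e_I of C^q and e_J of C^p.  Let
   U : e_I |-> e_{i_1} /\ ... /\ e_{i_(k-1)} and let V send e_J to the wedge of
   the increasing enumeration of the complement of J, times the signature of
   (J^c, J) and that of a fixed cyclic permutation (Hodge duality).  Both are
   unitary and V b_i = C_{e_i} U, so a |-> V a U^-1 maps H_n^k onto the creation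
   operators and preserves all the matrix norms.  The suprema defining the two
   cb-norms equal 1, and not less, because each b_i is a nonzero partial isometry.
   All signatures are handled as determinants of 0-1 matrices, for which the Gram
   formula for wedges turns V b_i = C_{e_i} U into a block determinant. *)

Require Import Defs.
From HB Require Import structures.
From mathcomp Require Import all_boot all_order all_fingroup all_algebra.
From mathcomp Require Import sesquilinear.
From mathcomp Require Import complex all_classical all_reals ereal.
From mathcomp Require Import zify.

Set Implicit Arguments.
Unset Strict Implicit.
Unset Printing Implicit Defensive.

Import Order.TTheory GRing.Theory Num.Theory.
Local Open Scope ring_scope.

(** * Signatures as determinants of 0-1 matrices *)

Section SequenceDeterminants.
Variables (F : comNzRingType) (T : eqType) (x0 : T).
Implicit Types s t u : seq T.

(** This generalised Kronecker delta is at once the signature of the permutation matching two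
    listings of one set and the Gram determinant of two families of canonical basis vectors. It
    vanishes by itself on repetitions and mismatches, so a single formula covers all cases. *)
Definition seq_det r s t : F :=
  \det (\matrix_(a < r, b < r) (nth x0 s a == nth x0 t b)%:R).

Lemma seq_detxx r s : size s = r -> uniq s -> seq_det r s s = 1.
Proof.
move=> sr us; rewrite /seq_det -[RHS](det1 F r); congr (\det _).
by apply/matrixP=> a b; rewrite !mxE nth_uniq ?sr.
Qed.

Lemma seq_det_notin r s t x : size s = r -> size t = r ->
  x \in s -> x \notin t -> seq_det r s t = 0.
Proof.
move=> sr tr xs xt; have ltx : (index x s < r)%N by rewrite -sr index_mem.
rewrite /seq_det (expand_det_row _ (Ordinal ltx)) big1 // => b _.
rewrite !mxE /= nth_index //; case: eqP => [xE|_]; last by rewrite mul0r.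
by case/negP: xt; rewrite xE mem_nth ?tr.
Qed.

Lemma seq_det_not_uniq r s t : size s = r -> ~~ uniq s -> seq_det r s t = 0.
Proof.
move=> sr /(uniqPn x0)[i [j [ij]]]; rewrite sr => jr e.
have ir := ltn_trans ij jr.
rewrite /seq_det (@determinant_alternate _ _ _ (Ordinal ir) (Ordinal jr)) //.
  by rewrite -val_eqE /= neq_ltn ij.
by move=> b; rewrite !mxE /= e.
Qed.

Lemma seq_det_perm r s t u (p : 'S_r) :
  (forall a : 'I_r, nth x0 s a = nth x0 t (p a)) ->
  seq_det r s u = (-1) ^+ p * seq_det r t u.
Proof.
move=> h; rewrite -det_perm -det_mulmx -row_permE; congr (\det _).
by apply/matrixP=> a b; rewrite !mxE h.
Qed.

Definition rot_perm r : 'S_r := perm (@ordS_inj r).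

(** Position a of [rcons s x] is position a + 1 of [x :: s], the last one wrapping around to the
    front. *)
Lemma seq_det_rcons r s x u : size s = r ->
  seq_det r.+1 (rcons s x) u = (-1) ^+ rot_perm r.+1 * seq_det r.+1 (x :: s) u.
Proof.
move=> sr; apply: seq_det_perm => a; rewrite permE /= nth_rcons sr.
have := ltn_ord a; rewrite ltnS leq_eqVlt => /predU1P[->|ar].
  by rewrite ltnn eqxx modnn.
by rewrite ar modn_small.
Qed.

End SequenceDeterminants.

(** * Splitting off a common tail, and the signature of a listing of ['I_n] *)

Section OrdinalSequences.
Variables (F : comNzRingType) (n : nat) (x0 : 'I_n).
Implicit Types s t u : seq 'I_n.
Local Notation D := (seq_det F x0).

(* The product of the first 0-1 matrix with the transpose of the second is block
   triangular, with an identity block since u has no repetition. *)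
Lemma seq_det_cat k p s t u : (k + p)%N = n ->
  size s = k -> size t = k -> size u = p -> uniq u ->
  (forall x, x \in t -> x \notin u) ->
  D n (s ++ u) (enum 'I_n) * D n (t ++ u) (enum 'I_n) = D k s t.
Proof.
move=> e sk tk up uu tu; rewrite -[X in _ * X]det_tr -det_mulmx.
have -> : (\matrix_(a < n, b < n) (nth x0 (s ++ u) a == nth x0 (enum 'I_n) b)%:R) *m
   (\matrix_(a < n, b < n) (nth x0 (t ++ u) a == nth x0 (enum 'I_n) b)%:R)^T =
   \matrix_(a, b) (nth x0 (s ++ u) a == nth x0 (t ++ u) b)%:R :> 'M[F]_n.
  apply/matrixP=> a b; rewrite !mxE (bigD1 (nth x0 (s ++ u) a)) //= !mxE.
  rewrite nth_ord_enum eqxx mul1r eq_sym big1 ?addr0 // => c /negPf.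
  by rewrite !mxE nth_ord_enum eq_sym => ->; rewrite mul0r.
rewrite /seq_det.
(* The equation k + p = n is eliminated so that the matrix can be cut into blocks. *)
transitivity (\det (\matrix_(a < k + p, b < k + p)
    (nth x0 (s ++ u) a == nth x0 (t ++ u) b)%:R) : F).
  by case: n / e x0 s t u {sk tk up uu tu}.
rewrite -[X in \det X]submxK.
have -> : dlsubmx (\matrix_(a < k + p, b < k + p)
    (nth x0 (s ++ u) a == nth x0 (t ++ u) b)%:R) = 0 :> 'M[F]_(p, k).
  apply/matrixP=> a b; rewrite !mxE !nth_cat /= sk tk ltn_ord.
  rewrite ltnNge leq_addr /= addKn; case: eqP => // eab.
  by have := tu (nth x0 t b); rewrite mem_nth ?tk // -eab mem_nth ?up // => /(_ isT).
rewrite det_ublock [X in _ * \det X](_ : _ = 1%:M) ?det1 ?mulr1.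
  by congr (\det _); apply/matrixP=> a b; rewrite !mxE !nth_cat /= sk tk !ltn_ord.
apply/matrixP=> a b; rewrite !mxE !nth_cat /= sk tk.
by rewrite !(ltnNge _ k) !leq_addr /= !addKn nth_uniq ?up.
Qed.

(** This links the choice of a permutation in [eps] to a determinant: a picked p sends the a-th
    entry of [s] to a, so [s] lists the values of the inverse of p, which has the same signature. *)
Lemma seq_det_pick s : size s = n -> uniq s ->
  (if [pick p : 'S_n | [seq p x | x <- s] == enum 'I_n]
   is Some p then (-1) ^+ odd_perm p else 0) = D n s (enum 'I_n).
Proof.
move=> sn us; case: pickP => [p /eqP sp|nop].
  rewrite (@seq_det_perm _ _ _ _ s (enum 'I_n) _ (p^-1)%g); last first.
    move=> a; apply: (@perm_inj _ p); rewrite nth_ord_enum permKV.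
    rewrite -(nth_map x0 (p x0)) ?sn // sp (set_nth_default x0) ?nth_ord_enum //.
    by rewrite size_enum_ord.
  by rewrite seq_detxx ?size_enum_ord ?enum_uniq // mulr1 odd_permV.
(* A pick always exists: the inverse of a |-> [nth x0 s a] qualifies. *)
have inj : injective (fun a : 'I_n => nth x0 s a).
  by move=> a b /eqP; rewrite nth_uniq ?sn // => /eqP/val_inj.
have := nop (perm inj)^-1%g; case/eqP.
apply: (@eq_from_nth _ x0) => [|i]; rewrite size_map sn.
  by rewrite size_enum_ord.
move=> ltin.
rewrite (nth_map x0) ?sn // -[i in LHS]/(val (Ordinal ltin)).
rewrite -[nth x0 s _](permE inj) permK.
by rewrite (nth_ord_enum x0 (Ordinal ltin)).
Qed.

End OrdinalSequences.

(** * Coordinates in orthonormal bases and conjugation by unitaries *)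

Section UnitaryEquivalence.
Variable R : realType.
Local Notation C := (R[i]).

Section OrthonormalBasis.
Variables (H : hilbert R) (q : nat) (w : 'I_q -> H).

Definition from_coord (x : Cn R q) : H := \sum_b (x : 'cV_q) b 0 *: w b.
Definition to_coord (y : H) : Cn R q := \col_b '[y, w b].

Lemma from_coord_linear : linear from_coord.
Proof.
move=> a x y; rewrite /from_coord scaler_sumr -big_split; apply: eq_bigr => b _ /=.
by rewrite !mxE scalerDl scalerA.
Qed.

Lemma to_coord_linear : linear to_coord.
Proof. by move=> a x y; apply/matrixP=> b j; rewrite !mxE linearPl. Qed.

HB.instance Definition _ :=
  GRing.isLinear.Build C (Cn R q) H *:%R from_coord from_coord_linear.
HB.instance Definition _ :=
  GRing.isLinear.Build C H (Cn R q) *:%R to_coord to_coord_linear.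

Hypothesis w_orthonormal : forall a b, '[w a, w b] = (a == b)%:R.
Hypothesis w_span : forall U : {vspace H}, (forall b, w b \in U) -> U = fullv.

Lemma from_coordK : cancel from_coord to_coord.
Proof.
move=> x; apply/matrixP=> b j; rewrite ord1 mxE hdot_suml (bigD1 b) //= hdotZl.
rewrite w_orthonormal eqxx mulr1 big1 ?addr0 // => a /negPf ab.
by rewrite hdotZl w_orthonormal ab mulr0.
Qed.

Lemma to_coordK : cancel to_coord from_coord.
Proof.
(* By [w_span] the map [from_coord] is onto, so its left inverse is also a right inverse. *)
move=> y; have /memv_imgP[x _ ->] : y \in (linfun from_coord @: fullv)%VS.
  rewrite (w_span (U := limg _)) ?memvf // => b.
  apply/memv_imgP; exists (delta_mx b 0); rewrite ?memvf // lfunE /= /from_coord.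
  rewrite (bigD1 b) //= mxE !eqxx scale1r big1 ?addr0 // => a /negPf ab.
  by rewrite mxE ab scale0r.
by rewrite lfunE /= from_coordK.
Qed.

Lemma from_coord_dot x : '[from_coord x, from_coord x] = '[x, x].
Proof.
(* Only the left argument is expanded; the other factor is the conjugate of a coordinate of x, read
   off through [from_coordK]. *)
rewrite {1}/from_coord hdot_suml; apply: eq_bigr => b _.
rewrite hdotZl; congr (_ * _); rewrite -[x in RHS]from_coordK mxE.
by rewrite [LHS]hermC mul1r.
Qed.

End OrthonormalBasis.

Section Transport.
Variables (H K H' K' : hilbert R).
Variables (U : 'Hom(H, H')) (U' : 'Hom(H', H)) (V : 'Hom(K, K')).

Definition transport (a : 'Hom(H, K)) : 'Hom(H', K') := (V \o a \o U')%VF.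

Lemma transport_linear : linear transport.
Proof.
move=> c a b; apply/lfunP=> x; rewrite /transport.
by rewrite !(comp_lfunE, add_lfunE, scale_lfunE) linearP.
Qed.

HB.instance Definition _ :=
  GRing.isLinear.Build C 'Hom(H, K) 'Hom(H', K') *:%R transport transport_linear.

Hypothesis UK : cancel U U'.
Hypothesis U'K : cancel U' U.
Hypothesis U_isom : forall x, '[U x, U x] = '[x, x].
Hypothesis V_isom : forall x, '[V x, V x] = '[x, x].

Lemma hnormm_isometry (L L' : hilbert R) (f : L -> L') m (x : 'I_m -> L) :
  (forall u, '[f u, f u] = '[u, u]) -> hnormm (f \o x) = hnormm x.
Proof. by move=> fi; congr Num.sqrt; apply: eq_bigr => j _ /=; rewrite fi. Qed.

(** [U'] maps the unit ball of m copies of [H'] onto that of m copies of [H], and [V] keeps the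
    norms of the outputs, so both suprema run over the same set of reals. *)
Lemma mxopnorm_transport m (A : 'M['Hom(H, K)]_m) :
  mxopnorm (map_mx transport A) = mxopnorm A.
Proof.
rewrite /mxopnorm; congr ereal_sup; apply/seteqP; split=> r /= [x x1 <-].
  exists (U' \o x).
    by rewrite -(hnormm_isometry (f := U)) // (_ : _ \o _ = x) //; apply/funext => j /=.
  congr (_%:E); rewrite -(hnormm_isometry (f := V)) //; congr hnormm; apply/funext => i /=.
  by rewrite linear_sum; apply: eq_bigr => j _; rewrite mxE !comp_lfunE.
exists (U \o x); first by rewrite hnormm_isometry.
congr (_%:E); rewrite -[RHS](hnormm_isometry (f := V)) //; congr hnormm.
apply/funext => i /=.
by rewrite linear_sum; apply: eq_bigr => j _; rewrite mxE !comp_lfunE UK.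
Qed.

End Transport.

Lemma mxopnorm1_eq1 (H K : hilbert R) (a : 'Hom(H, K)) (x0 : H) :
  (forall x, '[a x, a x] <= '[x, x]) -> '[x0, x0] = 1 -> '[a x0, a x0] = 1 ->
  mxopnorm (const_mx a : 'M_1) = 1%E.
Proof.
move=> ale x01 ax01; apply/eqP; rewrite eq_le; apply/andP; split.
  apply: ge_ereal_sup => _ [x /= x1 <-]; rewrite lee_fin; apply: le_trans x1.
  rewrite /hnormm; apply: ler_wsqrtr; apply: ler_sum => j _.
  rewrite big_ord_recl big_ord0 addr0 !mxE !ord1.
  by have := ale (x ord0); rewrite lecE => /andP[].
apply: ereal_sup_ubound; exists (fun=> x0).
  by rewrite /= /hnormm big_ord_recl big_ord0 addr0 x01 sqrtr1.
by rewrite /hnormm !big_ord_recl !big_ord0 !addr0 !mxE ax01 sqrtr1.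
Qed.

(** Transport preserves every matrix norm, so both cb-norms are at most 1; the element of norm 1
    makes the suprema reach 1. *)
Lemma completely_isometric_transport (H K H' K' : hilbert R)
    (E : {vspace 'Hom(H, K)}) (F : {vspace 'Hom(H', K')})
    (U : 'Hom(H, H')) (U' : 'Hom(H', H)) (V : 'Hom(K, K')) (V' : 'Hom(K', K)) :
  cancel U U' -> cancel U' U -> cancel V V' -> cancel V' V ->
  (forall x, '[U x, U x] = '[x, x]) -> (forall x, '[V x, V x] = '[x, x]) ->
  (forall a, a \in E -> transport U' V a \in F) ->
  (forall c, c \in F -> transport U V' c \in E) ->
  (exists2 a, a \in E & mxopnorm (const_mx a : 'M_1) = 1%E) ->
  completely_isometric E F.
Proof.
move=> UK U'K VK V'K Ui Vi EF FE [a0 a0E a01].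
have U'i x : '[U' x, U' x] = '[x, x] by rewrite -Ui U'K.
have V'i x : '[V' x, V' x] = '[x, x] by rewrite -Vi V'K.
pose T : 'Hom(subvs_of E, subvs_of F) := linfun (vsproj F \o transport U' V \o vsval).
pose T' : 'Hom(subvs_of F, subvs_of E) := linfun (vsproj E \o transport U V' \o vsval).
have TE a : vsval (T a) = transport U' V (vsval a).
  by rewrite lfunE /= vsprojK // EF // subvsP.
have T'E c : vsval (T' c) = transport U V' (vsval c).
  by rewrite lfunE /= vsprojK // FE // subvsP.
have Tn m (A : 'M_m) : mxopnorm (map_mx (fun a => vsval (T a)) A) = mxopnorm (map_mx vsval A).
  rewrite -(mxopnorm_transport (U' := U') (U := U) (V := V)) //.
  by congr mxopnorm; apply/matrixP=> i j; rewrite !mxE TE.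
have T'n m (A : 'M_m) : mxopnorm (map_mx (fun a => vsval (T' a)) A) = mxopnorm (map_mx vsval A).
  rewrite -(mxopnorm_transport (U' := U) (U := U') (V := V')) //.
  by congr mxopnorm; apply/matrixP=> i j; rewrite !mxE T'E.
have a0n : mxopnorm (map_mx vsval (const_mx (vsproj E a0) : 'M_1)) = 1%E.
  by rewrite map_const_mx /= vsprojK.
exists T, T'; split.
- move=> a; apply: val_inj; rewrite /= T'E TE; apply/lfunP=> x.
  by rewrite !comp_lfunE VK UK.
- move=> c; apply: val_inj; rewrite /= TE T'E; apply/lfunP=> x.
  by rewrite !comp_lfunE V'K U'K.
- apply/eqP; rewrite eq_le; apply/andP; split.
    by apply: ge_ereal_sup => _ [m [A [A1 ->]]]; rewrite Tn.
  (* Matrices have size m + 1, so m = 0 gives the 1 by 1 matrix with entry [a0]. *)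
  apply: ereal_sup_ubound; exists 0%N, (const_mx (vsproj E a0)).
  by rewrite Tn a0n.
- apply/eqP; rewrite eq_le; apply/andP; split.
    by apply: ge_ereal_sup => _ [m [A [A1 ->]]]; rewrite T'n.
  (* The image under [T] of the previous test matrix still has norm 1. *)
  apply: ereal_sup_ubound; exists 0%N, (map_mx T (const_mx (vsproj E a0))).
  have e : mxopnorm (map_mx vsval (map_mx T (const_mx (vsproj E a0) : 'M_1))) = 1%E.
    by rewrite -a0n -Tn; congr mxopnorm; apply/matrixP=> i j; rewrite !mxE.
  by rewrite T'n e.
Qed.

End UnitaryEquivalence.

(** * Wedges of canonical basis vectors in an abstract exterior power *)

Section WedgeBasis.
Variables (R : realType) (n : nat) (x0 : 'I_n).
Variable E : forall r, exterior_power R n r.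
Local Notation C := (R[i]).

Definition wedge_seq r (s : seq 'I_n) : E r :=
  wedge (E r) (ebasis_tuple R (fun a : 'I_r => nth x0 s a)).

Lemma wedge_seq_dot r s t : '[wedge_seq r s, wedge_seq r t] = seq_det C x0 r s t.
Proof.
rewrite wedge_dot gramE rows_ebasis map_rows_ebasis; congr (\det _).
apply/matrixP=> a b; rewrite !mxE (bigD1 (nth x0 s a)) //= !mxE eqxx mul1r.
by rewrite eq_sym big1 ?addr0 // => c /negPf; rewrite !mxE eq_sym => ->; rewrite mul0r.
Qed.

Lemma creation_wedge_seq r i s :
  creation E r (ebasis R i) (wedge_seq r s) = wedge_seq r.+1 (i :: s).
Proof.
rewrite creationE; congr (wedge _ _); apply: eq_from_tnth => a.
rewrite tnth_mktuple; case: (unliftP ord0 a) => [b ->|->]; last by rewrite tnth0.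
by rewrite tnthS tnth_mktuple.
Qed.

(** Instead of iterating multilinearity, both sides are paired with all wedges, which separate
    vectors; the identity becomes the expansion of the determinant of a product. *)
Lemma wedge_expand r (x : r.-tuple (Cn R n)) :
  wedge (E r) x = \sum_(t : {ffun 'I_r -> 'I_n})
    (\prod_a rows x a (t a)) *: wedge (E r) (ebasis_tuple R t).
Proof.
apply/eqP; rewrite -subr_eq0; apply/eqP/ext_eq0 => y.
rewrite hdotBl hdot_suml; apply/eqP; rewrite subr_eq0; apply/eqP.
rewrite wedge_dot gramE -det_mulmx_expand; apply: eq_bigr => t _.
by rewrite hdotZl wedge_dot gramE rows_ebasis mul_rowsub_mx mul1mx.
Qed.

(** The permutation sends a to the rank of [t a] in the increasing enumeration of the image; paired
    with any wedge, it permutes the rows of a Gram matrix. *)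
Lemma wedge_ebasis_inj r (t : 'I_r -> 'I_n) : injective t ->
  exists p : 'S_r, wedge (E r) (ebasis_tuple R t) =
    (-1) ^+ p *: wedge_seq r (enum (t @: 'I_r)).
Proof.
move=> tinj; set I := t @: 'I_r.
have sI : size (enum I) = r by rewrite -cardE card_imset // card_ord.
have tI a : t a \in enum I by rewrite mem_enum imset_f.
have ltI a : (index (t a) (enum I) < r)%N by rewrite -[X in (_ < X)%N]sI index_mem.
have pinj : injective (fun a => Ordinal (ltI a)).
  move=> a b /(congr1 val) /= /(congr1 (nth x0 (enum I))).
  by rewrite !nth_index // => /tinj.
exists (perm pinj); apply/eqP; rewrite -subr_eq0; apply/eqP/ext_eq0 => y.
rewrite hdotBl hdotZl !wedge_dot; apply/eqP; rewrite subr_eq0; apply/eqP.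
rewrite -det_perm -det_mulmx -row_permE; congr (\det _).
by apply/matrixP=> a b; rewrite !mxE !tnth_mktuple permE /= nth_index.
Qed.

Lemma wedge_enum_span r (U : {vspace E r}) :
  (forall I : {set 'I_n}, #|I| = r -> wedge_seq r (enum I) \in U) -> U = fullv.
Proof.
move=> UI; apply: wedge_span => x; rewrite wedge_expand.
apply: memv_suml => t _; apply: memvZ.
have [/injectiveP tinj|] := boolP (injectiveb t).
  have [p ->] := wedge_ebasis_inj tinj.
  by apply/memvZ/UI; rewrite card_imset // card_ord.
move=> /injectivePn[a [b ab tab]]; rewrite (wedge_alt _ ab) ?mem0v //.
by rewrite !tnth_mktuple tab.
Qed.

End WedgeBasis.

(** * The numbering of the subsets of given cardinality *)

Section Subsets.
Variables (n r : nat).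
Implicit Types (a b : 'I_('C(n, r))) (I : {set 'I_n}).

Definition nth_subset a : {set 'I_n} := nth finset.set0 (subsets n r) a.

Lemma mem_subsets I : (I \in subsets n r) = (#|I| == r).
Proof. by rewrite mem_sort mem_enum inE. Qed.

Lemma card_nth_subset a : #|nth_subset a| = r.
Proof. by apply/eqP; rewrite -mem_subsets mem_nth // size_subsets. Qed.

Lemma nth_subset_inj : injective nth_subset.
Proof.
move=> a b /eqP; rewrite nth_uniq ?size_subsets ?sort_uniq ?enum_uniq //.
by move=> /eqP/val_inj.
Qed.

Lemma nth_subset_surj I : #|I| = r -> exists a, I = nth_subset a.
Proof.
move=> /eqP; rewrite -mem_subsets => Ir.
have lt : (index I (subsets n r) < 'C(n, r))%N by rewrite -size_subsets index_mem.
by exists (Ordinal lt); rewrite /nth_subset /= nth_index.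
Qed.

End Subsets.

Lemma subset_basis_mulmxE (R : realType) n p q (I J : {set 'I_n}) a b :
  (subset_basis R p J *m (subset_basis R q I)^T) a b =
  ((nth_subset a == J) && (nth_subset b == I))%:R.
Proof. by rewrite !mxE big_ord_recl big_ord0 !mxE addr0 -natrM mulnb. Qed.

(** * The entries of b_i as determinants *)

Section SignMatrix.
Variables (R : realType) (n k : nat) (x0 i : 'I_n).
Hypothesis kn : (k < n)%N.
Local Notation C := (R[i]).

(** Together I and J have n - 1 elements, so if they are disjoint the complement of their union is a
    singleton, namely {i} as soon as i lies outside both. *)
Lemma uniq_cat_partition (I J : {set 'I_n}) : #|I| = k -> #|J| = (n - k.+1)%N ->
  uniq (enum I ++ i :: enum J) =
  (I :&: J == finset.set0) && (~: (I :|: J) == [set i]).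
Proof.
move=> Ik Jk; rewrite cat_uniq cons_uniq !enum_uniq andTb andbT mem_enum.
have -> : has (mem (enum I)) (i :: enum J) = (i \in I) || (I :&: J != finset.set0).
  rewrite /= mem_enum; congr (_ || _); apply/hasP/finset.set0Pn => -[x].
    rewrite -[mem _ x]/(x \in enum I) !mem_enum => xJ xI.
    by exists x; rewrite inE xI.
  by rewrite inE => /andP[xI xJ]; exists x; rewrite /= mem_enum.
rewrite negb_or negbK -andbA andbCA; have [IJ /=|//] := eqVneq.
rewrite eq_sym eqEcard finset.sub1set cards1 cardsCs finset.setCK cardsU IJ cards0 card_ord Ik Jk.
by rewrite !inE negb_or subn0 (_ : (_ <= 1)%N) ?andbT //; lia.
Qed.

Lemma bmxE a b : bmx R k.+1 i a b =
  seq_det C x0 n (enum (nth_subset b) ++ i :: enum (nth_subset a)) (enum 'I_n).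
Proof.
set I := nth_subset b; set J := nth_subset a.
have Ik : #|I| = k by exact: card_nth_subset.
have Jk : #|J| = (n - k.+1)%N by exact: card_nth_subset.
have sz : size (enum I ++ i :: enum J) = n.
  by rewrite size_cat /= -!cardE Ik Jk; lia.
transitivity (if uniq (enum I ++ i :: enum J) then eps R I i J else 0); last first.
  case: ifPn => [u|nu]; first exact: seq_det_pick.
  by rewrite seq_det_not_uniq.
(* At entry (a, b) only the pair with column set I and row set J can contribute. *)
rewrite summxE (bigD1 I) ?Ik //= [X in _ + X]big1 ?addr0; last first.
  move=> I' /andP[_ /negPf I'I]; rewrite summxE big1 // => J' _.
  by rewrite mxE subset_basis_mulmxE -/I [I == _]eq_sym I'I andbF mulr0.
rewrite summxE uniq_cat_partition //; case: ifPn => [IJ|nIJ].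
  rewrite (bigD1 J) ?Jk ?eqxx //= big1 ?addr0; last first.
    move=> J' /andP[_ /negPf J'J].
    by rewrite mxE subset_basis_mulmxE -/J eq_sym J'J mulr0.
  by rewrite mxE subset_basis_mulmxE -/I -/J !eqxx mulr1.
rewrite big1 // => J' /andP[_ IJ'].
rewrite mxE subset_basis_mulmxE -/I -/J.
have [e|_] := eqVneq J J'; last by rewrite mulr0.
by case/negP: nIJ; rewrite e.
Qed.

End SignMatrix.

Lemma hdotZr (R : realType) (H : hilbert R) (a : R[i]) (x y : H) :
  '[x, a *: y] = a^* * '[x, y].
Proof. exact: linearZr_LR. Qed.

Lemma seq_det_real (C : numClosedFieldType) (T : eqType) (x0 : T) r s t :
  (seq_det C x0 r s t)^* = seq_det C x0 r s t.
Proof.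
rewrite /seq_det -det_map_mx; congr (\det _).
by apply/matrixP=> a b; rewrite !mxE rmorph_nat.
Qed.

(** This is [seq_det_cat] with an empty tail. *)
Lemma seq_det_enum_sqr (F : comNzRingType) n (x0 : 'I_n) s : size s = n -> uniq s ->
  seq_det F x0 n s (enum 'I_n) * seq_det F x0 n s (enum 'I_n) = 1.
Proof.
move=> sn us; rewrite -[in LHS](cats0 s) (@seq_det_cat _ _ _ n 0) ?addn0 //.
exact: seq_detxx.
Qed.

(** * Matrices with at most one unimodular entry per row and column *)

Section PartialIsometry.
Variables (R : realType) (p q : nat) (B : 'M[R[i]]_(p, q)).
Variable c : 'I_p -> 'I_q -> bool.
Hypothesis c_fun : forall a b b', c a b -> c a b' -> b = b'.
Hypothesis c_inj : forall a a' b, c a b -> c a' b -> a = a'.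
Hypothesis B0 : forall a b, ~~ c a b -> B a b = 0.
Hypothesis B1 : forall a b, c a b -> `|B a b| = 1.

(** Each coordinate of B x is 0 or has the modulus of a single coordinate of x; since a column meets
    the support at most once, no coordinate of x is counted twice. *)
Lemma partial_isometry_contraction (x : Cn R q) :
  '[(B *m x : Cn R p), B *m x] <= '[x, x].
Proof.
rewrite /hdot /= /dotcv.
apply: (@le_trans _ _ (\sum_a \sum_(b | c a b) `|x b 0| ^+ 2)).
  apply: ler_sum => a _; rewrite -normCK mxE.
  case: (pickP (c a)) => [b cab|c0]; last first.
    by rewrite big1 ?normr0 ?expr0n ?sumr_ge0 // => b _; rewrite B0 ?mul0r ?c0.
  rewrite (bigD1 b) //= big1 ?addr0 => [|b' b'b]; last first.
    rewrite B0 ?mul0r //; apply: contra b'b => cab'; exact/eqP/(c_fun cab' cab).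
  rewrite normrM B1 // mul1r (bigD1 b) //= lerDl.
  by apply: sumr_ge0 => b' _; rewrite exprn_ge0.
rewrite (exchange_big_dep xpredT) //=; apply: ler_sum => b _; rewrite -normCK.
case: (pickP (c^~ b)) => [a cab|c0]; last by rewrite big_pred0 ?exprn_ge0.
rewrite (big_pred1 a) // => a'; apply/idP/eqP => [ca'b|->//]; exact: c_inj ca'b cab.
Qed.

Lemma partial_isometry_delta a b : c a b ->
  '[(B *m delta_mx b 0 : Cn R p), B *m delta_mx b 0] = 1.
Proof.
move=> cab; rewrite -colE /hdot /= /dotcv (bigD1 a) //= -normCK mxE B1 // expr1n.
rewrite big1 ?addr0 // => a' a'a; rewrite mxE B0 ?mul0r //.
by apply: contra a'a => ca'b; exact/eqP/(c_inj ca'b cab).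
Qed.

End PartialIsometry.

(** Given i, each of I and J determines the other; hence b_i is a partial permutation matrix up to
    signs. *)
Lemma uniq_cat_compl n k (i : 'I_n) (I J : {set 'I_n}) : (k < n)%N ->
  #|I| = k -> #|J| = (n - k.+1)%N -> uniq (enum I ++ i :: enum J) ->
  I = ~: (i |: J) /\ J = ~: (i |: I).
Proof.
move=> kn Ik Jk; rewrite (uniq_cat_partition _ kn) //.
case/andP=> /eqP/finset.setP h1 /eqP/finset.setP h2.
split; apply/finset.setP=> x; move: (h1 x) (h2 x); rewrite !inE.
  by case: (x \in I); case: (x \in J); case: (x == i).
by case: (x \in I); case: (x \in J); case: (x == i).
Qed.

(** * Each b_i has norm 1 *)

Section Hnk.
Variables (R : realType) (n k : nat).
Hypothesis kn : (k < n)%N.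
Local Notation C := (R[i]).

Definition bmx_supp (i : 'I_n) (a : 'I_('C(n, n - k.+1))) (b : 'I_('C(n, k))) :=
  uniq (enum (nth_subset b) ++ i :: enum (nth_subset a)).

Lemma bmx_supp_fun i a b b' : bmx_supp i a b -> bmx_supp i a b' -> b = b'.
Proof.
move=> /(uniq_cat_compl kn (card_nth_subset b) (card_nth_subset a))[e _].
move=> /(uniq_cat_compl kn (card_nth_subset b') (card_nth_subset a))[e' _].
by apply: nth_subset_inj; rewrite e e'.
Qed.

Lemma bmx_supp_inj i a a' b : bmx_supp i a b -> bmx_supp i a' b -> a = a'.
Proof.
move=> /(uniq_cat_compl kn (card_nth_subset b) (card_nth_subset a))[_ e].
move=> /(uniq_cat_compl kn (card_nth_subset b) (card_nth_subset a'))[_ e'].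
by apply: nth_subset_inj; rewrite e e'.
Qed.

Lemma size_bmx_supp i a b :
  size (enum (@nth_subset n k b) ++ i :: enum (@nth_subset n (n - k.+1) a)) = n.
Proof. by rewrite size_cat /= -!cardE !card_nth_subset; lia. Qed.

Lemma bmx_eq0 i a b : ~~ bmx_supp i a b -> bmx R k.+1 i a b = 0.
Proof. by move=> nu; rewrite (bmxE _ i) // seq_det_not_uniq // size_bmx_supp. Qed.

Lemma norm_bmx i a b : bmx_supp i a b -> `|bmx R k.+1 i a b| = 1.
Proof.
move=> u; apply/eqP; rewrite -(@eqrXn2 _ 2) // expr1n normCK (bmxE _ i) //.
by rewrite seq_det_real seq_det_enum_sqr // size_bmx_supp.
Qed.

Lemma bmx_supp_ex i : exists a b, bmx_supp i a b.
Proof.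
(* As k < n, there are at least k elements other than i: I takes the first k of them and J the
   rest. *)
pose s := take k (enum [set~ i]).
have sk : size s = k by rewrite size_takel // -cardE cardsC1 card_ord; lia.
have us : uniq s by rewrite take_uniq // enum_uniq.
have si : i \notin s.
  by apply/negP => /mem_take; rewrite mem_enum !inE eqxx.
pose I := [set x in s].
have Ik : #|I| = k by rewrite cardsE (card_uniqP us).
have iI : i \notin I by rewrite inE.
pose J := ~: (i |: I).
have Jk : #|J| = (n - k.+1)%N.
  by rewrite cardsCs finset.setCK cardsU1 iI Ik card_ord.
have [b Ib] := nth_subset_surj Ik; have [a Ja] := nth_subset_surj Jk.
exists a, b; rewrite /bmx_supp -Ib -Ja (uniq_cat_partition _ kn) //.
apply/andP; split; apply/eqP/finset.setP=> x; rewrite !inE.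
  by case: (x \in s); rewrite //= orbT.
by case: eqP => [->|_]; rewrite ?(negPf si) //; case: (x \in s).
Qed.

Lemma mxopnorm_bmx i : mxopnorm (const_mx (linfun (mulmx (bmx R k.+1 i)) :
  'Hom(Cn R 'C(n, k), Cn R 'C(n, n - k.+1))) : 'M_1) = 1%E.
Proof.
have [a [b cab]] := bmx_supp_ex i.
apply: (@mxopnorm1_eq1 R (Cn R 'C(n, k)) (Cn R 'C(n, n - k.+1)) _ (delta_mx b 0)) => [x||];
  rewrite ?lfunE /=.
- by apply: (partial_isometry_contraction (@bmx_supp_fun i) (@bmx_supp_inj i));
    [exact: bmx_eq0|exact: norm_bmx].
- rewrite /hdot /= /dotcv (bigD1 b) //= mxE !eqxx mul1r conjC1 big1 ?addr0 //.
  by move=> b' /negPf b'b; rewrite mxE b'b mul0r.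
- exact: (partial_isometry_delta (@bmx_supp_inj i) (@bmx_eq0 i) (@norm_bmx i) cab).
Qed.

End Hnk.

(** * Hodge duality and the complete isometry *)

Section CompleteIsometry.
Variables (R : realType) (n k : nat) (x0 : 'I_n).
Hypothesis kn : (k < n)%N.
Variable E : forall r, exterior_power R n r.
Local Notation C := (R[i]).

Definition wedge_set r (I : {set 'I_n}) : E r := wedge_seq x0 E r (enum I).

Lemma wedge_set_dot r (I J : {set 'I_n}) : #|I| = r -> #|J| = r ->
  '[wedge_set r I, wedge_set r J] = (I == J)%:R.
Proof.
move=> Ir Jr; rewrite wedge_seq_dot.
have [->|IJ] := eqVneq I J; first by rewrite seq_detxx ?enum_uniq // -cardE.
have /subsetPn[x xI xJ] : ~~ (I \subset J).
  by apply: contraNN IJ => sIJ; rewrite eqEcard sIJ Ir Jr leqnn.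
by rewrite (@seq_det_notin _ _ _ _ _ _ x) ?mem_enum // -cardE.
Qed.

(* The sign of the rotation makes up for eps (I, i, J) having i after I, whereas
   C_{e_i} puts e_i in front. *)
Definition hodge_sign (J : {set 'I_n}) : C :=
  (-1) ^+ rot_perm k.+1 * seq_det C x0 n (enum (~: J) ++ enum J) (enum 'I_n).

Lemma hodge_sign_real J : (hodge_sign J)^* = hodge_sign J.
Proof. by rewrite rmorphM /= seq_det_real rmorph_sign. Qed.

Lemma uniq_enum_compl (J : {set 'I_n}) : uniq (enum (~: J) ++ enum J).
Proof.
rewrite cat_uniq !enum_uniq andbT /=; apply/hasPn => x; rewrite mem_enum => xJ.
by rewrite /= mem_enum inE xJ.
Qed.

Lemma size_enum_compl (J : {set 'I_n}) : size (enum (~: J) ++ enum J) = n.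
Proof. by rewrite size_cat -!cardE addnC cardsC card_ord. Qed.

Lemma hodge_sign_sqr J : hodge_sign J * hodge_sign J = 1.
Proof.
rewrite /hodge_sign mulrACA -signr_addb addbb mul1r.
by rewrite seq_det_enum_sqr ?uniq_enum_compl ?size_enum_compl.
Qed.

(** [wedge_basis] and [hodge_basis] list the images U e_I and V e_J of the canonical bases. *)
Definition wedge_basis (b : 'I_('C(n, k))) : E k := wedge_set k (nth_subset b).
Definition hodge_basis (a : 'I_('C(n, n - k.+1))) : E k.+1 :=
  hodge_sign (nth_subset a) *: wedge_set k.+1 (~: nth_subset a).

Lemma card_compl_nth a : #|~: @nth_subset n (n - k.+1) a| = k.+1.
Proof. by rewrite cardsCs finset.setCK card_ord card_nth_subset subKn. Qed.

Lemma wedge_basis_orthonormal a b : '[wedge_basis a, wedge_basis b] = (a == b)%:R.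
Proof. by rewrite wedge_set_dot ?card_nth_subset // (inj_eq (@nth_subset_inj _ _)). Qed.

Lemma hodge_basis_orthonormal a b : '[hodge_basis a, hodge_basis b] = (a == b)%:R.
Proof.
rewrite hdotZl hdotZr hodge_sign_real wedge_set_dot ?card_compl_nth //.
rewrite (inj_eq (can_inj (@finset.setCK _))) (inj_eq (@nth_subset_inj _ _)).
by have [->|_] := eqVneq; rewrite ?eqxx ?mulr1 ?mulr0 ?hodge_sign_sqr.
Qed.

Lemma wedge_basis_span (U : {vspace E k}) : (forall b, wedge_basis b \in U) -> U = fullv.
Proof.
move=> wU; apply: (@wedge_enum_span _ _ x0) => I /nth_subset_surj[b ->]; exact: wU.
Qed.

Lemma hodge_basis_span (U : {vspace E k.+1}) : (forall a, hodge_basis a \in U) -> U = fullv.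
Proof.
move=> vU; apply: (@wedge_enum_span _ _ x0) => I Ik.
have /nth_subset_surj[a Ia] : #|~: I| = (n - k.+1)%N.
  by rewrite cardsCs finset.setCK card_ord Ik.
(* The sign is its own inverse. *)
have -> : wedge_seq x0 E k.+1 (enum I) = hodge_sign (nth_subset a) *: hodge_basis a.
  by rewrite scalerA hodge_sign_sqr scale1r -Ia finset.setCK.
exact/memvZ/vU.
Qed.

(** The rotation sign moves i behind I. By [seq_det_cat] with tail J, the remaining determinant of
    size k + 1 is the entry of b_i times the signature of (J^c, J), which cancels against the same
    signature in [hodge_sign]. *)
Lemma creation_dot i a b :
  '[creation E k (ebasis R i) (wedge_basis b), hodge_basis a] = bmx R k.+1 i a b.
Proof.
rewrite hdotZr hodge_sign_real creation_wedge_seq wedge_seq_dot.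
set I := nth_subset b; set J := nth_subset a.
have Ik : size (enum I) = k by rewrite -cardE card_nth_subset.
rewrite (bmxE _ x0) // -/I -/J -cat_rcons /hodge_sign mulrAC -seq_det_rcons //.
rewrite -(@seq_det_cat _ _ _ k.+1 (n - k.+1) _ _ (enum J)) ?subnKC ?size_rcons ?Ik //.
- by rewrite -mulrA seq_det_enum_sqr ?mulr1 ?uniq_enum_compl ?size_enum_compl.
- by rewrite -cardE card_compl_nth.
- by rewrite -cardE card_nth_subset.
- exact: enum_uniq.
- by move=> x; rewrite !mem_enum inE.
Qed.

(** Both operators have the same matrix in the bases [wedge_basis] and [hodge_basis], by
    [creation_dot]. *)
Lemma transport_bmx i :
  transport (linfun (to_coord wedge_basis)) (linfun (from_coord hodge_basis))
    (linfun (mulmx (bmx R k.+1 i))) = creation E k (ebasis R i).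
Proof.
apply/lfunP=> y; rewrite !comp_lfunE !lfunE /=.
rewrite -[y in RHS](to_coordK wedge_basis_orthonormal wedge_basis_span) /from_coord linear_sum /=.
transitivity (\sum_b to_coord wedge_basis y b 0 *: \sum_a bmx R k.+1 i a b *: hodge_basis a).
  under [RHS]eq_bigr do rewrite scaler_sumr; rewrite exchange_big /=.
  apply: eq_bigr => a _; rewrite mxE scaler_suml; apply: eq_bigr => b _.
  by rewrite [RHS]scalerA mulrC.
apply: eq_bigr => b _; rewrite linearZ /=; congr (_ *: _).
rewrite -[RHS](to_coordK hodge_basis_orthonormal hodge_basis_span) /from_coord.
by apply: eq_bigr => a _; rewrite mxE creation_dot.
Qed.

Lemma completely_isometric_Hnk_Cnk : completely_isometric (Hnk R n k.+1) (Cnk E k.+1).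
Proof.
pose U := linfun (from_coord wedge_basis); pose U' := linfun (to_coord wedge_basis).
pose V := linfun (from_coord hodge_basis); pose V' := linfun (to_coord hodge_basis).
have UK : cancel U U'
  by move=> x; rewrite !lfunE /= from_coordK //; exact: wedge_basis_orthonormal.
have U'K : cancel U' U.
  move=> x; rewrite !lfunE /= to_coordK //.
    exact: wedge_basis_orthonormal.
  exact: wedge_basis_span.
have VK : cancel V V'
  by move=> x; rewrite !lfunE /= from_coordK //; exact: hodge_basis_orthonormal.
have V'K : cancel V' V.
  move=> x; rewrite !lfunE /= to_coordK //.
    exact: hodge_basis_orthonormal.
  exact: hodge_basis_span.
have TE i : transport U' V (linfun (mulmx (bmx R k.+1 i))) = creation E k (ebasis R i).
  exact: transport_bmx.
apply: (completely_isometric_transport UK U'K VK V'K).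
- by move=> x; rewrite lfunE /=; apply: from_coord_dot; exact: wedge_basis_orthonormal.
- by move=> x; rewrite lfunE /=; apply: from_coord_dot; exact: hodge_basis_orthonormal.
(* Phrased as inclusion in a preimage, the claim need only be checked on the generators b_i. *)
- move=> a; have /subvP/(_ a) : (Hnk R n k.+1 <= linfun (transport U' V) @^-1: Cnk E k.+1)%VS.
    apply/span_subvP=> _ /mapP[i _ ->]; rewrite -memv_preim lfunE /= TE.
    exact/memv_span/map_f/mem_enum.
  by move=> h /h; rewrite -memv_preim lfunE.
- move=> a; have /subvP/(_ a) : (Cnk E k.+1 <= linfun (transport U V') @^-1: Hnk R n k.+1)%VS.
    apply/span_subvP=> _ /mapP[i _ ->]; rewrite -memv_preim lfunE /= -TE.
    rewrite (_ : transport U V' _ = linfun (mulmx (bmx R k.+1 i))).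
      exact/memv_span/map_f/mem_enum.
    by apply/lfunP=> x; rewrite !comp_lfunE VK UK.
  by move=> h /h; rewrite -memv_preim lfunE.
(* Any b_i serves as the element of norm 1. *)
- exists (linfun (mulmx (bmx R k.+1 x0))); last exact: mxopnorm_bmx.
  exact/memv_span/map_f/mem_enum.
Qed.

End CompleteIsometry.

Theorem lemma2p1 (R : realType) (n k : nat) (hk : (1 <= k <= n)%N)
    (E : forall r : nat, exterior_power R n r) :
  completely_isometric (Hnk R n k) (Cnk E k).
Proof.
case: k hk => // k kn.
(* After the shift of k by one, k < n makes 0 an element of ['I_n], used as the default [x0]. *)
exact: (completely_isometric_Hnk_Cnk (Ordinal (leq_ltn_trans (leq0n k) kn)) kn).
Qed.
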